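(* Let $P$ be a fake projective plane with fundamental group $\Pi\subset{\rm PU}(2,1)$, and let $\widetilde\Pi$ be the inverse image of $\Pi$ in ${\rm SU}(2,1)$. If the short exact sequence $\{1\}\to Z\to\widetilde\Pi\to\Pi\to\{1\}$, where $Z$ is the center (of order $3$) of ${\rm SU}(2,1)$, splits, then the canonical line bundle $K_P$ of $P$ is three times a holomorphic line bundle, i.e. there is a holomorphic line bundle $L$ on $P$ such that $K_P=3L$ (additive notation in the Picard group).
   Context: A fake projective plane is a smooth compact complex surface which is not $\mathbf P^2_{\mathbb C}$ but has the same Betti numbers as $\mathbf P^2_{\mathbb C}$. Such a surface is a quotient $P=B/\Pi$ of the open unit ball $B\subset\mathbb C^2$ (the symmetric space of ${\rm PU}(2,1)$) by its fundamental group $\Pi$, a torsion-free cocompact discrete subgroup of ${\rm PU}(2,1)$. The map ${\rm SU}(2,1)\to{\rm PU}(2,1)$ is the natural surjection, whose kernel is the center of ${\rm SU}(2,1)$. *)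

(* Defs.v *)
From HB Require Import structures.
From mathcomp Require Import all_boot all_order all_algebra.
From mathcomp Require Import all_classical all_reals all_analysis.
From mathcomp Require Import complex.
Set Implicit Arguments.
Unset Strict Implicit.
Unset Printing Implicit Defensive.
Import Order.TTheory GRing.Theory Num.Theory numFieldNormedType.Exports.
Local Open Scope classical_set_scope.
Local Open Scope quotient_scope.
Local Open Scope ring_scope.

(* [R[i]] seen as a [numClosedFieldType], the structure which carries the
   topology and for which [differentiable] is complex differentiability. *)
Definition Cplx (R : realType) : numClosedFieldType := R[i]%C.

Section SingularHomology.
Variables (R : realType) (X : topologicalType).

Definition std_simplex n : set 'rV[R]_n.+1 :=
  [set t | (forall i, 0 <= t 0 i) /\ \sum_i t 0 i = 1].
Arguments std_simplex : clear implicits.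

Lemma face_subproof n (i : 'I_n.+2) (t : std_simplex n) :
  (\row_j (if unlift i j is Some k then set_val t 0 k else 0))
    \in std_simplex n.+1.
Proof.
have [t_ge0 t_sum1] := set_valP t; apply/mem_set; split.
  by move=> j; rewrite mxE; case: unlift.
rewrite -t_sum1 (bigD1_ord i) //= mxE unlift_none add0r.
by apply: eq_bigr => k _; rewrite mxE liftK.
Qed.

Definition face n (i : 'I_n.+2) (t : std_simplex n) : std_simplex n.+1 :=
  SigSub (face_subproof i t).

Definition sing_simplex n : Type :=
  set_type [set s : std_simplex n -> X | continuous s].

HB.instance Definition _ n := Choice.on (sing_simplex n).

Definition is_chain n (c : sing_simplex n -> rat) : Prop :=
  finite_set [set s | c s != 0].

(* The coefficient of [t] in the boundary of [\sum_s c s *: s]. *)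
Definition boundary n (c : sing_simplex n.+1 -> rat) (t : sing_simplex n) : rat :=
  \sum_(s \in [set: sing_simplex n.+1])
    (c s * \sum_(i < n.+2)
       (-1) ^+ i * (`[< set_val t = set_val s \o face i >])%:R).

Definition is_cycle n : (sing_simplex n -> rat) -> Prop :=
  match n with
  | 0 => fun c => is_chain c
  | m.+1 => fun c => is_chain c /\ forall t, boundary c t = 0
  end.

(* The [d] classes of the [z i] form a basis of [H_k(X; Q)]. *)
Definition has_betti (k d : nat) : Prop :=
  exists z : 'I_d -> sing_simplex k -> rat,
    (forall i, is_cycle (z i)) /\
    forall c : sing_simplex k -> rat, is_cycle c ->
      exists! a : 'rV[rat]_d, exists b : sing_simplex k.+1 -> rat,
        is_chain b /\
        forall s, c s = \sum_(i < d) a 0 i * z i s + boundary b s.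

End SingularHomology.
Arguments std_simplex : clear implicits.

Definition same_betti (R : realType) (X Y : topologicalType) : Prop :=
  forall k d, has_betti R X k d <-> has_betti R Y k d.

Section ComplexSurfaces.
Variable R : realType.
Local Notation C := (Cplx R).

(* [chart_map i] and [chart_inv i] are only meaningful on [chart_dom i] and
   [chart_cod i] respectively. *)
Record atlas (X : topologicalType) := Atlas {
  chart_index : Type;
  chart_dom : chart_index -> set X;
  chart_cod : chart_index -> set 'rV[C]_2;
  chart_map : chart_index -> X -> 'rV[C]_2;
  chart_inv : chart_index -> 'rV[C]_2 -> X }.

Definition is_complex_atlas (X : topologicalType) (A : atlas X) : Prop :=
  [/\ forall x, exists i, chart_dom (a := A) i x,
      forall i : chart_index A, open (chart_dom i) /\ open (chart_cod i),
      forall i : chart_index A,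
        (forall x, chart_dom i x ->
           chart_cod i (chart_map i x) /\ chart_inv i (chart_map i x) = x) /\
        (forall z, chart_cod i z ->
           chart_dom i (chart_inv i z) /\ chart_map i (chart_inv i z) = z),
      forall i : chart_index A,
        {within chart_dom i, continuous (chart_map i)} /\
        {within chart_cod i, continuous (chart_inv i)} &
      forall (i j : chart_index A) (z : 'rV[C]_2),
        chart_cod i z -> chart_dom j (chart_inv i z) ->
        differentiable (chart_map j \o chart_inv i) z].

Definition complex_surface (X : topologicalType) (A : atlas X) : Prop :=
  [/\ hausdorff_space X, @second_countable X, connected [set: X] &
      is_complex_atlas A].

Definition holomorphic_on (X : topologicalType) (A : atlas X)
    (W : set X) (f : X -> C) : Prop :=
  forall (i : chart_index A) (z : 'rV[C]_2),
    chart_cod i z -> W (chart_inv i z) -> differentiable (f \o chart_inv i) z.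

Definition holomorphic_map (X Y : topologicalType) (A : atlas X) (B : atlas Y)
    (f : X -> Y) : Prop :=
  continuous f /\
  forall (i : chart_index A) (j : chart_index B) (z : 'rV[C]_2),
    chart_cod i z -> chart_dom j (f (chart_inv i z)) ->
    differentiable (chart_map j \o f \o chart_inv i) z.

Definition biholomorphic (X Y : topologicalType) (A : atlas X) (B : atlas Y) :
    Prop :=
  exists (f : X -> Y) (g : Y -> X),
    [/\ cancel f g, cancel g f, holomorphic_map A B f & holomorphic_map B A g].

(* Over [lb_open j], a section is a function [f j]; on overlaps
   [f j = lb_trans j k * f k]. *)
Record line_bundle_data (X : topologicalType) := LineBundleData {
  lb_index : Type;
  lb_open : lb_index -> set X;
  lb_trans : lb_index -> lb_index -> X -> C }.

Definition holomorphic_line_bundle (X : topologicalType) (A : atlas X)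
    (L : line_bundle_data X) : Prop :=
  [/\ forall x, exists j, lb_open (l := L) j x,
      forall j : lb_index L, open (lb_open j),
      forall j k : lb_index L,
        holomorphic_on A (lb_open j `&` lb_open k) (lb_trans j k),
      forall (j k : lb_index L) x, lb_open j x -> lb_open k x ->
        lb_trans j k x != 0 &
      forall (j k l : lb_index L) x,
        lb_open j x -> lb_open k x -> lb_open l x ->
        lb_trans j l x = lb_trans j k x * lb_trans k l x].

(* An isomorphism sends the section [f j] of [L] to the section
   [h j k * f j] of [M] over [lb_open j `&` lb_open k]. *)
Definition line_bundle_iso (X : topologicalType) (A : atlas X)
    (L M : line_bundle_data X) : Prop :=
  exists h : lb_index L -> lb_index M -> X -> C,
    (forall j k, holomorphic_on A (lb_open j `&` lb_open k) (h j k)) /\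
    (forall j k x, lb_open j x -> lb_open k x -> h j k x != 0) /\
    (forall j j' k k' x,
       lb_open j x -> lb_open j' x -> lb_open k x -> lb_open k' x ->
       h j k x * lb_trans j j' x = lb_trans k k' x * h j' k' x).

(* Addition in the Picard group. *)
Definition line_bundle_tensor (X : topologicalType) (L M : line_bundle_data X) :
    line_bundle_data X :=
  {| lb_index := (lb_index L * lb_index M)%type;
     lb_open := fun j => lb_open j.1 `&` lb_open j.2;
     lb_trans := fun j k x => lb_trans j.1 k.1 x * lb_trans j.2 k.2 x |}.

(* A 2-form is [f i dz_1 /\ dz_2] in the chart [i], so that [f i] is [f j] times
   the Jacobian determinant of the change of charts from [i] to [j]. *)
Definition canonical_bundle (X : topologicalType) (A : atlas X) :
    line_bundle_data X :=
  {| lb_index := chart_index A;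
     lb_open := @chart_dom X A;
     lb_trans := fun i j x =>
       \det (jacobian (chart_map j \o chart_inv i) (chart_map i x)) |}.

Definition nonzero_vec : set 'rV[C]_3 := [set v | v != 0].

Lemma nonzero_vecP (v : nonzero_vec) : set_val v != 0.
Proof. exact: (set_valP v). Qed.

Definition proj_rel : rel nonzero_vec :=
  fun v w => `[< exists c : C, set_val v = c *: set_val w >].

Lemma proj_rel_equiv : equiv_class_of proj_rel.
Proof.
have sym v w : proj_rel v w -> proj_rel w v.
  move=> /asboolP[c cE]; apply/asboolP; exists c^-1; rewrite cE scalerA.
  have c0 : c != 0.
    by have := nonzero_vecP v; rewrite cE scaler_eq0 => /norP[].
  by rewrite mulVf// scale1r.
split=> [v|v w|w v u].
- by apply/asboolP; exists 1; rewrite scale1r.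
- by apply/idP/idP; exact: sym.
- move=> /asboolP[c cE] /asboolP[d dE]; apply/asboolP.
  by exists (c * d); rewrite cE dE scalerA.
Qed.

Canonical proj_equiv := EquivRelPack proj_rel_equiv.

Definition projective_plane := quotient_topology {eq_quot proj_rel}.

HB.instance Definition _ := Topological.on projective_plane.
HB.instance Definition _ := Quotient.on projective_plane.

Definition homogeneous_coords (x : projective_plane) : 'rV[C]_3 :=
  set_val (repr x : nonzero_vec).

Lemma affine_vec_subproof (i : 'I_3) (z : 'rV[C]_2) :
  (\row_k (if unlift i k is Some j then z 0 j else 1)) \in nonzero_vec.
Proof.
apply/mem_set/eqP => /rowP/(_ i); rewrite !mxE unlift_none.
exact/eqP/oner_neq0.
Qed.

Definition affine_vec (i : 'I_3) (z : 'rV[C]_2) : nonzero_vec :=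
  SigSub (affine_vec_subproof i z).

Definition projective_plane_atlas : atlas projective_plane :=
  {| chart_index := 'I_3;
     chart_dom := fun i => [set x | homogeneous_coords x 0 i != 0];
     chart_cod := fun=> setT;
     chart_map := fun i x =>
       \row_(j < 2)
         (homogeneous_coords x 0 (lift i j) / homogeneous_coords x 0 i);
     chart_inv := fun i z => \pi_projective_plane (affine_vec i z) |}.

Definition fake_projective_plane (X : topologicalType) (A : atlas X) : Prop :=
  [/\ complex_surface A,
      compact [set: X],
      ~ biholomorphic A projective_plane_atlas &
      same_betti R X projective_plane].

End ComplexSurfaces.

Section UnitaryGroups.
Variable R : realType.
Local Notation C := (Cplx R).

Definition herm_form : 'M[C]_3 := block_mx (1%:M : 'M[C]_2) 0 0 ((-1)%:M : 'M[C]_1).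

Definition preserves_form (A : 'M[C]_3) : Prop :=
  (map_mx Num.conj A)^T *m herm_form *m A = herm_form.

Lemma herm_formK : herm_form *m herm_form = 1%:M.
Proof.
apply: etrans (@mulmx_block C 2 1 2 1 2 1 _ _ _ _ _ _ _ _) _.
rewrite !mulmx0 !mul0mx !mulmx1 !addr0 add0r -scalar_mxM mulrNN mulr1.
by rewrite -scalar_mx_block.
Qed.

Definition form_inv (A : 'M[C]_3) : 'M[C]_3 :=
  herm_form *m (map_mx Num.conj A)^T *m herm_form.

Lemma form_invK A : preserves_form A -> form_inv A *m A = 1%:M.
Proof. by move=> AE; rewrite /form_inv -!mulmxA [X in _ *m X]mulmxA AE herm_formK. Qed.

Lemma form_inv_invmx A : preserves_form A -> A \in unitmx /\ form_inv A = invmx A.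
Proof.
move=> /form_invK AE; have [_ Au] := mulmx1_unit AE; split=> //.
by rewrite -[LHS]mulmx1 -(mulmxV Au) mulmxA AE mul1mx.
Qed.

Lemma preserves_form1 : preserves_form 1%:M.
Proof. by rewrite /preserves_form map_mx1 trmx1 mul1mx mulmx1. Qed.

Lemma preserves_formM A B :
  preserves_form A -> preserves_form B -> preserves_form (A *m B).
Proof.
move=> AE BE; rewrite /preserves_form map_mxM trmx_mul.
by rewrite -[RHS]BE -[in RHS]AE !mulmxA.
Qed.

Lemma preserves_formV A : preserves_form A -> preserves_form (invmx A).
Proof.
move=> AE; have [Au _] := form_inv_invmx AE.
rewrite /preserves_form -[X in _ *m X *m _]AE !mulmxA -trmx_mul -map_mxM mulmxV//.
by rewrite map_mx1 trmx1 mul1mx -mulmxA mulmxV// mulmx1.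
Qed.

Definition U21 : Type := set_type [set A : 'M[C]_3 | preserves_form A].
Definition SU21 : Type :=
  set_type [set A : 'M[C]_3 | preserves_form A /\ \det A = 1].

HB.instance Definition _ := Topological.on U21.
HB.instance Definition _ := SubType.on U21.
HB.instance Definition _ := Topological.on SU21.
HB.instance Definition _ := SubType.on SU21.

Definition U21_mx (u : U21) : 'M[C]_3 := set_val u.
Definition SU21_mx (u : SU21) : 'M[C]_3 := set_val u.

Lemma U21_mxP u : preserves_form (U21_mx u). Proof. exact: (set_valP u). Qed.
Lemma SU21_mxP u : preserves_form (SU21_mx u) /\ \det (SU21_mx u) = 1.
Proof. exact: (set_valP u). Qed.
Lemma U21_mx_inj : injective U21_mx. Proof. exact: val_inj. Qed.
Lemma SU21_mx_inj : injective SU21_mx. Proof. exact: val_inj. Qed.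

Definition mkU21 A (h : preserves_form A) : U21 := SigSub (mem_set h).
Definition mkSU21 A (h : preserves_form A /\ \det A = 1) : SU21 :=
  SigSub (mem_set h).

Lemma U21_unit u : U21_mx u \in unitmx.
Proof. by have [] := form_inv_invmx (U21_mxP u). Qed.

Lemma SU21_unit u : SU21_mx u \in unitmx.
Proof. by have [] := form_inv_invmx (SU21_mxP u).1. Qed.

Definition U21_one : U21 := mkU21 preserves_form1.
Definition U21_mul (u v : U21) : U21 :=
  mkU21 (preserves_formM (U21_mxP u) (U21_mxP v)).
Definition U21_inv (u : U21) : U21 := mkU21 (preserves_formV (U21_mxP u)).

Lemma U21_mulA : associative U21_mul.
Proof. by move=> u v w; apply/U21_mx_inj/mulmxA. Qed.
Lemma U21_mul1 : left_id U21_one U21_mul.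
Proof. by move=> u; apply/U21_mx_inj/mul1mx. Qed.
Lemma U21_mulr1 : right_id U21_one U21_mul.
Proof. by move=> u; apply/U21_mx_inj/mulmx1. Qed.
Lemma U21_mulV : left_inverse U21_one U21_inv U21_mul.
Proof. by move=> u; apply/U21_mx_inj/mulVmx/U21_unit. Qed.
Lemma U21_mulrV : right_inverse U21_one U21_inv U21_mul.
Proof. by move=> u; apply/U21_mx_inj/mulmxV/U21_unit. Qed.

HB.instance Definition _ :=
  isGroup.Build U21 U21_mulA U21_mul1 U21_mulr1 U21_mulV U21_mulrV.

Lemma SU21_one_subproof : preserves_form 1%:M /\ \det (1%:M : 'M[C]_3) = 1.
Proof. by split; [exact: preserves_form1|exact: det1]. Qed.

Lemma SU21_mul_subproof (u v : SU21) :
  preserves_form (SU21_mx u *m SU21_mx v) /\ \det (SU21_mx u *m SU21_mx v) = 1.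
Proof.
have [[pu du] [pv dv]] := (SU21_mxP u, SU21_mxP v).
by split; [exact: preserves_formM|rewrite det_mulmx du dv mulr1].
Qed.

Lemma SU21_inv_subproof (u : SU21) :
  preserves_form (invmx (SU21_mx u)) /\ \det (invmx (SU21_mx u)) = 1.
Proof.
have [pu du] := SU21_mxP u.
by split; [exact: preserves_formV|rewrite det_inv du invr1].
Qed.

Definition SU21_one : SU21 := mkSU21 SU21_one_subproof.
Definition SU21_mul (u v : SU21) : SU21 := mkSU21 (SU21_mul_subproof u v).
Definition SU21_inv (u : SU21) : SU21 := mkSU21 (SU21_inv_subproof u).

Lemma SU21_mulA : associative SU21_mul.
Proof. by move=> u v w; apply/SU21_mx_inj/mulmxA. Qed.
Lemma SU21_mul1 : left_id SU21_one SU21_mul.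
Proof. by move=> u; apply/SU21_mx_inj/mul1mx. Qed.
Lemma SU21_mulr1 : right_id SU21_one SU21_mul.
Proof. by move=> u; apply/SU21_mx_inj/mulmx1. Qed.
Lemma SU21_mulV : left_inverse SU21_one SU21_inv SU21_mul.
Proof. by move=> u; apply/SU21_mx_inj/mulVmx/SU21_unit. Qed.
Lemma SU21_mulrV : right_inverse SU21_one SU21_inv SU21_mul.
Proof. by move=> u; apply/SU21_mx_inj/mulmxV/SU21_unit. Qed.

HB.instance Definition _ :=
  isGroup.Build SU21 SU21_mulA SU21_mul1 SU21_mulr1 SU21_mulV SU21_mulrV.

(* [PU(2,1) = U(2,1) / U(1)]; a scalar [c] relating two elements of [U(2,1)]
   automatically has modulus 1. *)
Definition PU21_rel : rel U21 :=
  fun u v => `[< exists c : C, U21_mx u = c *: U21_mx v >].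

Lemma U21_mx_neq0 u : U21_mx u != 0.
Proof.
by apply/eqP => u0; have := U21_unit u; rewrite u0 unitmxE det0 unitr0.
Qed.

Lemma PU21_rel_equiv : equiv_class_of PU21_rel.
Proof.
have sym u v : PU21_rel u v -> PU21_rel v u.
  move=> /asboolP[c cE]; apply/asboolP; exists c^-1; rewrite cE scalerA.
  have c0 : c != 0 by have := U21_mx_neq0 u; rewrite cE scaler_eq0 => /norP[].
  by rewrite mulVf// scale1r.
split=> [u|u v|v u w].
- by apply/asboolP; exists 1; rewrite scale1r.
- by apply/idP/idP; exact: sym.
- move=> /asboolP[c cE] /asboolP[d dE]; apply/asboolP.
  by exists (c * d); rewrite cE dE scalerA.
Qed.

Canonical PU21_equiv := EquivRelPack PU21_rel_equiv.

Definition PU21 := quotient_topology {eq_quot PU21_rel}.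

HB.instance Definition _ := Topological.on PU21.
HB.instance Definition _ := Quotient.on PU21.

Definition U21_to_PU21 (u : U21) : PU21 := \pi_PU21 u.

Lemma U21_to_PU21P u v :
  U21_to_PU21 u = U21_to_PU21 v <-> exists c : C, U21_mx u = c *: U21_mx v.
Proof.
have uvP := @eqmodP _ PU21_equiv u v.
by split=> [/uvP/asboolP|/asboolP/uvP].
Qed.

Definition PU21_one : PU21 := U21_to_PU21 1%g.
Definition PU21_mul (x y : PU21) : PU21 := U21_to_PU21 (repr x * repr y)%g.
Definition PU21_inv (x : PU21) : PU21 := U21_to_PU21 (repr x)^-1%g.

Lemma PU21P (x : PU21) : exists u, x = U21_to_PU21 u.
Proof. by exists (repr x); rewrite /U21_to_PU21 reprK. Qed.

Lemma repr_U21_to_PU21 u :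
  exists c : C, U21_mx (repr (U21_to_PU21 u)) = c *: U21_mx u.
Proof. by apply/U21_to_PU21P; rewrite /U21_to_PU21 reprK. Qed.

Lemma PU21_mulE u v :
  PU21_mul (U21_to_PU21 u) (U21_to_PU21 v) = U21_to_PU21 (u * v)%g.
Proof.
apply/U21_to_PU21P.
have [c cE] := repr_U21_to_PU21 u; have [d dE] := repr_U21_to_PU21 v.
exists (c * d); change (U21_mx (repr (U21_to_PU21 u)) *m
  U21_mx (repr (U21_to_PU21 v)) = (c * d) *: (U21_mx u *m U21_mx v)).
by rewrite cE dE -scalemxAl -scalemxAr scalerA.
Qed.

Lemma PU21_invE u : PU21_inv (U21_to_PU21 u) = U21_to_PU21 u^-1%g.
Proof.
apply/U21_to_PU21P; have [c cE] := repr_U21_to_PU21 u; exists c^-1.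
change (invmx (U21_mx (repr (U21_to_PU21 u))) = c^-1 *: invmx (U21_mx u)).
have c0 : c != 0.
  by have := U21_mx_neq0 (repr (U21_to_PU21 u)); rewrite cE scaler_eq0 => /norP[].
by rewrite cE invmxZ// -cE U21_unit.
Qed.

Lemma PU21_mulA : associative PU21_mul.
Proof.
move=> x y z; have [[u ->] [v ->] [w ->]] := And3 (PU21P x) (PU21P y) (PU21P z).
by rewrite !PU21_mulE mulgA.
Qed.
Lemma PU21_mul1 : left_id PU21_one PU21_mul.
Proof. by move=> x; have [u ->] := PU21P x; rewrite PU21_mulE mul1g. Qed.
Lemma PU21_mulr1 : right_id PU21_one PU21_mul.
Proof. by move=> x; have [u ->] := PU21P x; rewrite PU21_mulE mulg1. Qed.
Lemma PU21_mulV : left_inverse PU21_one PU21_inv PU21_mul.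
Proof.
by move=> x; have [u ->] := PU21P x; rewrite PU21_invE PU21_mulE mulVg.
Qed.
Lemma PU21_mulrV : right_inverse PU21_one PU21_inv PU21_mul.
Proof.
by move=> x; have [u ->] := PU21P x; rewrite PU21_invE PU21_mulE mulgV.
Qed.

HB.instance Definition _ :=
  isGroup.Build PU21 PU21_mulA PU21_mul1 PU21_mulr1 PU21_mulV PU21_mulrV.

Definition SU21_to_PU21 (u : SU21) : PU21 := U21_to_PU21 (mkU21 (SU21_mxP u).1).

Lemma SU21_to_PU21M (u v : SU21) :
  SU21_to_PU21 (u * v)%g = (SU21_to_PU21 u * SU21_to_PU21 v)%g.
Proof.
rewrite -[RHS]/(PU21_mul _ _) PU21_mulE; congr U21_to_PU21.
exact: U21_mx_inj.
Qed.

End UnitaryGroups.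

Section Subgroups.
Variable R : realType.
Local Notation C := (Cplx R).
Variable Pi : groupClosed (PU21 R).

Definition torsion_free : Prop :=
  forall (g : PU21 R) (n : nat), g \in Pi -> (0 < n)%N -> (g ^+ n = 1)%g -> g = 1%g.

Definition discrete_subgroup : Prop :=
  isolated [set g : PU21 R | g \in Pi] = [set g : PU21 R | g \in Pi].

Definition coset_rel : rel (PU21 R) := fun g h => (g / h)%g \in Pi.

Lemma coset_rel_equiv : equiv_class_of coset_rel.
Proof.
split=> [g|g h|h g k].
- by rewrite /coset_rel divgg gpred1.
- by rewrite /coset_rel -invgF gpredV.
- rewrite /coset_rel => gh hk.
  have -> : (g / k = (g / h) * (h / k))%g by rewrite mulgA mulgVK.
  exact: gpredM.
Qed.

Canonical coset_equiv := EquivRelPack coset_rel_equiv.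

Definition coset_space := quotient_topology {eq_quot coset_rel}.
HB.instance Definition _ := Topological.on coset_space.

Definition cocompact : Prop := compact [set: coset_space].

Definition SU21_preimage : set (SU21 R) := [set u | SU21_to_PU21 u \in Pi].

(* [s] is a homomorphic section of the projection onto [Pi]; its values outside
   [Pi] are irrelevant. *)
Definition extension_splits : Prop :=
  exists s : PU21 R -> SU21 R,
    [/\ {in Pi, forall g, SU21_preimage (s g)},
        {in Pi, forall g, SU21_to_PU21 (s g) = g} &
        {in Pi &, {morph s : g h / (g * h)%g}}].

Definition unit_ball_set : set 'rV[C]_2 :=
  [set z | \sum_(i < 2) `|z 0 i| ^+ 2 < 1].

Definition unit_ball : Type := set_type unit_ball_set.
HB.instance Definition _ := Topological.on unit_ball.
HB.instance Definition _ := SubType.on unit_ball.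

Definition hvec (z : 'rV[C]_2) : 'cV[C]_3 := (row_mx z (1%:M : 'M[C]_1))^T.

(* [g z = w] for the action of [PU(2,1)] on the ball, identified with the set
   of points [(z_1 : z_2 : 1)] of the projective plane. *)
Definition moves (g : PU21 R) (z w : 'rV[C]_2) : Prop :=
  exists c : C, U21_mx (repr g) *m hvec z = c *: hvec w.

Lemma hvec_neq0 z : hvec z != 0.
Proof.
apply/eqP => /(congr1 (fun v : 'cV[C]_(2 + 1) => rsubmx v^T)).
rewrite trmxK trmx0 row_mxKr => /matrixP/(_ 0 0); rewrite !mxE.
exact/eqP/oner_neq0.
Qed.

Lemma moves_pi u z w :
  moves (U21_to_PU21 u) z w <-> exists c : C, U21_mx u *m hvec z = c *: hvec w.
Proof.
have [d dE] := repr_U21_to_PU21 u.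
have d0 : d != 0.
  by have := U21_mx_neq0 (repr (U21_to_PU21 u)); rewrite dE scaler_eq0 => /norP[].
rewrite /moves dE -scalemxAl; split=> -[c cE].
  by exists (d^-1 * c); rewrite -scalerA -cE scalerA mulVf// scale1r.
by exists (d * c); rewrite cE scalerA.
Qed.

Lemma moves1 z : moves 1%g z z.
Proof. by apply/(moves_pi 1%g); exists 1; rewrite scale1r mul1mx. Qed.

Lemma movesM g h z w t : moves g w t -> moves h z w -> moves (g * h)%g z t.
Proof.
have [u ->] := PU21P g; have [v ->] := PU21P h.
move=> /moves_pi[c cE] /moves_pi[d dE].
rewrite -[(_ * _)%g]/(PU21_mul _ _) PU21_mulE; apply/moves_pi.
exists (d * c); change (U21_mx u *m U21_mx v *m hvec z = (d * c) *: hvec t).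
by rewrite -mulmxA dE -scalemxAr cE scalerA.
Qed.

Lemma movesV g z w : moves g z w -> moves g^-1%g w z.
Proof.
have [u ->] := PU21P g; move=> /moves_pi[c cE].
rewrite -[(_ ^-1)%g]/(PU21_inv _) PU21_invE; apply/moves_pi.
have c0 : c != 0.
  apply/eqP => c0; have /eqP := hvec_neq0 z; apply.
  by rewrite -[LHS](mulKmx (U21_unit u)) cE c0 scale0r mulmx0.
exists c^-1; change (invmx (U21_mx u) *m hvec w = c^-1 *: hvec z).
rewrite -[in RHS](mulKmx (U21_unit u) (hvec z)) cE -scalemxAr scalerA mulVf//.
by rewrite scale1r.
Qed.

Definition orbit_rel : rel unit_ball :=
  fun z w => `[< exists2 g : PU21 R, g \in Pi & moves g (set_val z) (set_val w) >].

Lemma orbit_rel_equiv : equiv_class_of orbit_rel.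
Proof.
have sym z w : orbit_rel z w -> orbit_rel w z.
  move=> /asboolP[g gP gzw]; apply/asboolP; exists g^-1%g; rewrite ?gpredV//.
  exact: movesV.
split=> [z|z w|w z t].
- by apply/asboolP; exists 1%g; [exact: gpred1|exact: moves1].
- by apply/idP/idP; exact: sym.
- move=> /asboolP[g gP gzw] /asboolP[h hP hwt]; apply/asboolP.
  by exists (h * g)%g; [exact: gpredM|exact: movesM hwt gzw].
Qed.

Canonical orbit_equiv := EquivRelPack orbit_rel_equiv.

Definition ball_quotient := quotient_topology {eq_quot orbit_rel}.
HB.instance Definition _ := Topological.on ball_quotient.
HB.instance Definition _ := Quotient.on ball_quotient.

Definition ball_proj (z : unit_ball) : ball_quotient := \pi_ball_quotient z.

Lemma ball0_subproof : (0 : 'rV[C]_2) \in unit_ball_set.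
Proof.
apply/mem_set; rewrite /unit_ball_set /= big1 ?ltr01// => i _.
by rewrite mxE normr0 expr0n.
Qed.

Definition ball0 : unit_ball := SigSub ball0_subproof.

(* The complex structure for which [ball_proj] is locally biholomorphic: the
   charts are the inverses of the restrictions of [ball_proj] to the open sets
   on which it is injective. *)
Definition ball_quotient_atlas : atlas R ball_quotient :=
  {| chart_index :=
       {V : set unit_ball | open V /\ set_inj V ball_proj};
     chart_dom := fun V => ball_proj @` sval V;
     chart_cod := fun V => set_val @` sval V;
     chart_map := fun V x =>
       set_val (xget ball0 [set z | sval V z /\ ball_proj z = x]);
     chart_inv := fun V z => ball_proj (insubd ball0 z) |}.

End Subgroups.

(* Main.v *)
Require Import Defs.
From HB Require Import structures.
From mathcomp Require Import all_boot all_order all_algebra.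
From mathcomp Require Import all_classical all_reals all_analysis.
From mathcomp Require Import complex ring.
Import Order.TTheory GRing.Theory Num.Theory numFieldNormedType.Exports.

(** Write a matrix [A] acting on the ball as [A (z, 1) = j(A, z) (A z, 1)]. The
    automorphy factor [j(A, z)], called [automorphy A z] below, is affine in [z],
    satisfies the cocycle rule [j(AB, z) = j(A, Bz) j(B, z)] ([automorphyM]), and
    the Jacobian determinant of [z |-> A z] is [det A / j(A, z)^3]
    ([det_jacobian_frac_action]).

    The canonical bundle of the quotient of the ball by [Pi] therefore has
    transition functions [j(A, z)^-3], where [A] in SU(2,1) lifts the element
    [g] of [Pi] relating two charts. Taking the cube root [j(A, z)^-1] is tempting,
    but [A] is determined by [g] only up to a cube root of unity, so that in
    general one gets a cocycle only up to cube roots of unity. A splitting [s] of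
    the extension removes this ambiguity: with [A = s g] the functions
    [j(s g, z)^-1] form a cocycle ([cube_root_transM]), hence a holomorphic line
    bundle whose third power is canonical ([canonical_transE]).

    For this, [g] must be determined by the two charts and the point over which
    they are compared ([moves_inj]). This is read off from the existence of
    injective charts: an element with a fixed point in a chart fixes a
    neighbourhood of it ([fixpoint_trivial]), and a matrix for which an open set
    of points is fixed is scalar ([near_fix_scalar]). *)

(** * Differentials of germs and of row-valued maps *)

Section Differentials.
Set Implicit Arguments.
Unset Strict Implicit.
Local Open Scope classical_set_scope.
Local Open Scope ring_scope.

(** The differential is a choice among the linear maps that fit the first-order
    expansion, so it depends only on the germ: the expansion of [f] is one of
    [g], and the differential is unique. *)
Lemma near_eq_diff (K : numFieldType) (V W : normedModType K) (f g : V -> W)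
    (x : V) : (\forall y \near x, f y = g y) -> differentiable f x ->
  differentiable g x /\ 'd g x = 'd f x :> (V -> W).
Proof.
move=> fg df.
have fgx : f x = g x by exact: nbhs_singleton fg.
have gE : g \o shift x = cst (g x) + 'd f x +o_ 0 id.
  apply/eqaddoP => e e0.
  have := diff_locally df => /eqaddoP /(_ e e0).
  move: fg; rewrite (near_shift 0 x) subr0 => fg.
  by apply: filterS2 fg => y /= fgy; rewrite !fctE /= fgy fgx.
have dgE : 'd g x = 'd f x :> (V -> W).
  by apply: diff_unique gE; exact: diff_continuous.
split=> //; apply/diff_locallyP; rewrite dgE; split=> //.
exact: diff_continuous.
Qed.

Lemma near_eq_jacobian (K : numFieldType) m n (f g : 'rV[K]_m -> 'rV[K]_n)
    (x : 'rV[K]_m) : (\forall y \near x, f y = g y) -> differentiable f x ->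
  jacobian g x = jacobian f x.
Proof.
move=> fg df; have [_ dfg] := near_eq_diff fg df.
apply/matrixP => i j; rewrite [LHS]mxE [RHS]mxE.
exact: (congr1 (fun h : 'rV[K]_m -> 'rV[K]_n => h (delta_mx 0 i) 0 j) dfg).
Qed.

Lemma is_diff_row (K : numFieldType) (V : normedModType K) n
    (f : V -> 'rV[K]_n) (df : 'I_n -> V -> K) (x : V) :
  (forall j, is_diff x (fun y => f y 0 j : K) (df j)) ->
  is_diff x f (fun v => \row_j df j v).
Proof.
move=> fdf.
have fE : f = \sum_j (fun y => f y 0 j *: delta_mx 0 j).
  apply/funext => y; rewrite fct_sumE [LHS]row_sum_delta.
  by apply: eq_bigr.
have dfx : differentiable f x.
  by rewrite fE; apply: differentiable_sum => j; exact: differentiableZl.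
split=> //; apply/funext => v; apply/rowP => j; rewrite mxE.
have @c : {linear 'rV[K]_n -> K}.
  by exists (fun N : 'rV[K]_n => N 0 j); do 2![eexists]; do ?[constructor];
     rewrite ?mxE// => ? *; rewrite ?mxE//; move=> ?; rewrite !mxE.
have cc : continuous c by exact: coord_continuous.
have dc y : differentiable c y by exact: linear_differentiable.
have := diff_comp dfx (dc (f x)); rewrite diff_lin//.
move=> /(congr1 (fun h => h v)) /= <-.
by rewrite -[LHS]/('d (fun y => f y 0 j : K) x v) diff_val.
Qed.

End Differentials.

(** * The fractional linear action and its automorphy factor *)

Section ProjectiveAction.
Set Implicit Arguments.
Unset Strict Implicit.
Local Open Scope classical_set_scope.
Local Open Scope ring_scope.
Variable R : realType.
Local Notation C := (Cplx R).
Implicit Types (A B : 'M[C]_3) (z w v : 'rV[C]_2).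

Definition affine_ix (j : 'I_2) : 'I_3 := lshift 1 j.
Definition last_ix : 'I_3 := rshift 2 0.

(** The last coordinate of [A (z, 1)], that is, the factor by which [A] scales
    the lift [(z, 1)] of the point [z]: the classical automorphy factor. *)
Definition automorphy A z : C := (A *m hvec z) last_ix 0.

Definition frac_action A z : 'rV[C]_2 :=
  \row_j ((A *m hvec z) (affine_ix j) 0 / automorphy A z).

Lemma affine_or_lastP (i : 'I_3) : (exists j, i = affine_ix j) \/ i = last_ix.
Proof.
case: (@splitP 2 1 i) => j ij; [left; exists j|right]; apply: val_inj => //=.
by rewrite ij (ord1 j).
Qed.

Lemma ord2P (j : 'I_2) : j = 0 \/ j = 1.
Proof. by case: j => -[|[|//]] lt2; [left|right]; exact: val_inj. Qed.

Lemma hvec_affine z j : hvec z (affine_ix j) 0 = z 0 j.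
Proof. by rewrite mxE row_mxEl. Qed.

Lemma hvec_last z : hvec z last_ix 0 = 1.
Proof. by rewrite mxE row_mxEr mxE eqxx. Qed.

Lemma hvec_eqP z (x : 'cV[C]_3) :
  (forall j, x (affine_ix j) 0 = z 0 j) -> x last_ix 0 = 1 -> x = hvec z.
Proof.
move=> xz x1; apply/matrixP => i k; rewrite (ord1 k) {k}.
by case: (affine_or_lastP i) => [[j]|] ->; rewrite ?xz ?x1 ?hvec_affine ?hvec_last.
Qed.

Lemma frac_actionE A z : automorphy A z != 0 ->
  A *m hvec z = automorphy A z *: hvec (frac_action A z).
Proof.
move=> j0; apply: (can_inj (scalerK (invr_neq0 j0))).
rewrite scalerK//; apply: hvec_eqP => [i|]; last by rewrite mxE mulVf.
by rewrite mxE [RHS]mxE mulrC.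
Qed.

Lemma frac_action_unique A z w (c : C) :
  A *m hvec z = c *: hvec w -> c != 0 -> automorphy A z = c /\ frac_action A z = w.
Proof.
move=> cE c0; have jE : automorphy A z = c.
  by rewrite /automorphy cE mxE hvec_last mulr1.
split=> //; apply/rowP => i; rewrite mxE jE cE mxE hvec_affine.
by rewrite mulrC mulKf.
Qed.

(** The cocycle rule [j(AB, z) = j(A, Bz) j(B, z)]. *)
Lemma automorphyM A B z w (c : C) : B *m hvec z = c *: hvec w ->
  automorphy (A *m B) z = automorphy A w * automorphy B z.
Proof.
move=> BE; rewrite /automorphy -mulmxA BE -scalemxAr [LHS]mxE mulrC; congr (_ * _).
by rewrite mxE hvec_last mulr1.
Qed.

Lemma mul_hvecE A i z :
  (A *m hvec z) i 0 = \sum_k z 0 k * A i (affine_ix k) + A i last_ix.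
Proof.
rewrite mxE (@big_split_ord _ _ _ 2 1) /= big_ord1 -/last_ix hvec_last mulr1.
by congr (_ + _); apply: eq_bigr => k _; rewrite -/(affine_ix k) hvec_affine mulrC.
Qed.

Lemma is_diff_mul_hvec A i z :
  is_diff z (fun y => (A *m hvec y) i 0 : C)
    (fun v => \sum_k v 0 k * A i (affine_ix k)).
Proof.
pose f := fun v : 'rV[C]_2 => \sum_k v 0 k * A i (affine_ix k) : C.
have f_lin : linear f.
  move=> a u v; rewrite /f scaler_sumr -big_split /=.
  by apply: eq_bigr => k _; rewrite !mxE mulrDl -mulrA.
have df x : differentiable f x.
  rewrite (_ : f = \sum_k (fun v => v 0 k * A i (affine_ix k) : C)); last first.
    by apply/funext => v; rewrite fct_sumE.
  apply: differentiable_sum => k.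
  by apply: differentiableM => //; exact: differentiable_coord.
have f_cont : continuous f by move=> x; exact: differentiable_continuous.
have dfE : 'd f z = f :> (_ -> _).
  pose fL : {linear 'rV[C]_2 -> C} :=
    HB.pack f (GRing.isLinear.Build _ _ _ _ _ f_lin).
  exact: (@diff_lin _ _ _ fL).
have -> : (fun y => (A *m hvec y) i 0 : C) = f + cst (A i last_ix).
  by apply/funext => y; exact: mul_hvecE.
have fd : is_diff z f f by split.
by have := is_diffD fd (is_diff_cst (A i last_ix) z); rewrite [f + 0]addr0.
Qed.

Lemma is_diff_frac_action A z : automorphy A z != 0 ->
  is_diff z (frac_action A) (fun v => \row_j
    ((\sum_k v 0 k * (A (affine_ix j) (affine_ix k) -
                      frac_action A z 0 j * A last_ix (affine_ix k)))
      / automorphy A z)).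
Proof.
move=> j0; apply: is_diff_row => j.
have dn := is_diff_mul_hvec A (affine_ix j) z.
have dd : is_diff z (automorphy A) (fun v => \sum_k v 0 k * A last_ix (affine_ix k)).
  exact: is_diff_mul_hvec.
have dinv : is_diff z (fun y => (automorphy A y)^-1)
    (- automorphy A z ^- 2 *: (fun v => \sum_k v 0 k * A last_ix (affine_ix k) : C)).
  split; first by apply: differentiableV => //; exact: ex_diff.
  by rewrite (diffV (@ex_diff _ _ _ _ _ _ _ dd) j0) (diff_val (is_diff_def := dd)).
have -> : (fun y => frac_action A y 0 j : C) =
    (fun y => (A *m hvec y) (affine_ix j) 0 : C) * (fun y => (automorphy A y)^-1).
  by apply/funext => y; rewrite mxE.
apply: (is_diff_eq (is_diffM dn dinv)).
apply/funext => v; rewrite !fctE /= [frac_action A z 0 j]mxE.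
move: j0 (_ 0 : C) => /=; set a := automorphy A z => a0 n.
rewrite !big_ord_recl !big_ord0 /GRing.scale /=.
by field.
Qed.

(** Multiply [A] on the right by the unipotent matrix with last column
    [(z, 1)] and on the left by the one that subtracts [f = A z] times the last
    row: the last column becomes [(0, a)] with [a = j(A, z)], and the upper left
    block becomes [D = Aul - f^T Adl]. Hence [det A = a det D], whereas the
    quotient rule says that the Jacobian matrix is [D^T / a]. *)
Lemma det_jacobian_frac_action A z : automorphy A z != 0 ->
  \det (jacobian (frac_action A) z) = \det A / automorphy A z ^+ 3.
Proof.
move=> j0; have dA := is_diff_frac_action j0.
have jE i j : jacobian (frac_action A) z i j =
    (A (affine_ix j) (affine_ix i) - frac_action A z 0 j * A last_ix (affine_ix i))
      / automorphy A z.
  rewrite /jacobian mxE diff_val mxE (bigD1 i)//= mxE !eqxx mul1r big1 ?addr0//.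
  by move=> k ki; rewrite mxE (negbTE ki) andbF mul0r.
set f := frac_action A z; set a := automorphy A z.
pose Aul : 'M[C]_2 := @ulsubmx _ 2 1 2 1 A.
pose Aur : 'cV[C]_2 := @ursubmx _ 2 1 2 1 A.
pose Adl : 'rV[C]_2 := @dlsubmx _ 2 1 2 1 A.
pose Adr : 'M[C]_1 := @drsubmx _ 2 1 2 1 A.
pose D := Aul - f^T *m Adl.
have detA : \det A = \det D * a.
  have : A *m hvec z = a *: hvec f by exact: frac_actionE.
  rewrite -[A in A *m _](@submxK _ 2 1 2 1) /hvec !tr_row_mx trmx1.
  rewrite (@mul_block_col _ 2 1 2 1) (@scale_col_mx _ 2 1) !mulmx1.
  move=> /(@eq_col_mx _ 2 1)[Eu Ed].
  have E : block_mx 1%:M (- f^T) 0 1%:M *m block_mx Aul Aur Adl Adr *m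
      block_mx 1%:M z^T 0 1%:M = block_mx D 0 Adl a%:M.
    rewrite !mulmx_block !mul1mx !mulmx0 !mulmx1 !mul0mx !addr0 !add0r.
    congr block_mx; rewrite ?mulNmx//.
      rewrite mulmxDl addrACA Eu mulNmx -mulmxA -opprD -mulmxDr Ed.
      by rewrite -scalemxAr mulmx1 subrr.
    by rewrite Ed scalemx1.
  move/(congr1 determinant): E.
  rewrite !det_mulmx !det_ublock det_lblock !det1 !mul1r !mulr1 det_scalar1.
  by rewrite submxK.
have -> : jacobian (frac_action A) z = a^-1 *: D^T.
  apply/matrixP => i j; rewrite jE !mxE big_ord1 !mxE mulrC; congr (_ * _).
by rewrite detZ det_tr detA; field.
Qed.

Lemma differentiable_automorphy A z : differentiable (automorphy A) z.
Proof. exact: (@ex_diff _ _ _ _ _ _ _ (is_diff_mul_hvec A last_ix z)). Qed.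

Lemma near_automorphy_neq0 A z : automorphy A z != 0 ->
  \forall y \near z, automorphy A y != 0.
Proof.
move=> a0; have /differentiable_continuous c := differentiable_automorphy A z.
exact: cvgr_neq0 c a0.
Qed.

(** Near [z] the vectors lifting [z], [z + t e1], [z + t e2] and
    [z + t (e1 + e2)] are all eigenvectors of [A]. For [t != 0] they are four
    points in general position of the projective plane, and a projective map
    fixing these is the identity. *)
Lemma near_fix_scalar A z :
  (\forall y \near z, exists c : C, A *m hvec y = c *: hvec y) ->
  exists c : C, A = c%:M.
Proof.
move=> fixA.
have near_fix v : \forall t \near (0 : C)^',
    exists c : C, A *m hvec (t *: v + z) = c *: hvec (t *: v + z).
  have /differentiable_continuous c : differentiable (fun t : C => t *: v + z) 0.
    exact: differentiableD.
  apply: cvg_within.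
  apply: (c [set y | exists c : C, A *m hvec y = c *: hvec y]).
  by rewrite /= scale0r add0r.
pose e1 : 'rV[C]_2 := delta_mx 0 0; pose e2 : 'rV[C]_2 := delta_mx 0 1.
have [c0 E0] := nbhs_singleton fixA.
have nz : \forall t \near (0 : C)^', t != 0 by exact: nbhs_dnbhs_neq.
have [t [[t0 [c1 E1]] [[c2 E2] [c3 E3]]]] := filter_ex
  (filterI (filterI nz (near_fix e1)) (filterI (near_fix e2) (near_fix (e1 + e2)))).
have eqn v c : A *m hvec (t *: v + z) = c *: hvec (t *: v + z) -> forall i,
    t * (\sum_k v 0 k * A i (affine_ix k)) + c0 * hvec z i 0 = c * hvec (t *: v + z) i 0.
  move=> + i => /matrixP/(_ i 0); rewrite [RHS]mxE => <-.
  move/matrixP/(_ i 0): E0; rewrite [RHS]mxE => <-.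
  rewrite !mul_hvecE addrA mulr_sumr -big_split /=; congr (_ + _).
  by apply: eq_bigr => k _; rewrite !mxE mulrDl mulrA.
have sum2 (f : 'I_2 -> C) (v : 'rV[C]_2) :
    \sum_k v 0 k * f k = v 0 0 * f 0 + v 0 1 * f 1.
  by rewrite big_ord_recl big_ord1 (_ : lift _ _ = 1)//; exact: val_inj.
have eqn_last v c : A *m hvec (t *: v + z) = c *: hvec (t *: v + z) ->
    t * (v 0 0 * A last_ix (affine_ix 0) + v 0 1 * A last_ix (affine_ix 1)) + c0 = c.
  by move=> /eqn/(_ last_ix); rewrite sum2 !hvec_last !mulr1.
have eqn_affine v c j : A *m hvec (t *: v + z) = c *: hvec (t *: v + z) ->
    t * (v 0 0 * A (affine_ix j) (affine_ix 0) +
         v 0 1 * A (affine_ix j) (affine_ix 1)) + c0 * z 0 j =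
    c * (t * v 0 j + z 0 j).
  move=> /eqn/(_ (affine_ix j)); rewrite sum2 hvec_affine => ->.
  by rewrite hvec_affine !mxE.
have e1E : e1 0 0 = 1 /\ e1 0 1 = 0 by rewrite !mxE.
have e2E : e2 0 0 = 0 /\ e2 0 1 = 1 by rewrite !mxE.
have e12E : (e1 + e2) 0 0 = 1 /\ (e1 + e2) 0 1 = 1 by rewrite !mxE !(addr0, add0r).
move: (eqn_last _ _ E1) (eqn_affine _ _ 0 E1) (eqn_affine _ _ 1 E1).
move: (eqn_last _ _ E2) (eqn_affine _ _ 0 E2) (eqn_affine _ _ 1 E2).
move: (eqn_last _ _ E3) (eqn_affine _ _ 0 E3) (eqn_affine _ _ 1 E3).
rewrite e1E.1 e1E.2 e2E.1 e2E.2 e12E.1 e12E.2.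
rewrite !mul1r !mul0r !mulr1 !mulr0 !addr0 !add0r.
move=> L3 X3 Y3 L2 X2 Y2 L1 X1 Y1.
(* The last row reads [c3 = c1 + c2 - c0]; the two affine rows then give
   [c1 = c3] and [c2 = c3], so the four eigenvalues agree. *)
have c3E : c3 = c1 + c2 - c0 by rewrite -L3 -L2 -L1; ring.
have c13 : c1 = c3.
  apply/subr0_eq/(mulfI t0); rewrite mulr0.
  have -> : t * (c1 - c3) =
      c1 * (t + z 0 0) + c2 * z 0 0 - c3 * (t + z 0 0) - c0 * z 0 0.
    by rewrite c3E; ring.
  by rewrite -X1 -X2 -X3; ring.
have c23 : c2 = c3.
  apply/subr0_eq/(mulfI t0); rewrite mulr0.
  have -> : t * (c2 - c3) =
      c2 * (t + z 0 1) + c1 * z 0 1 - c3 * (t + z 0 1) - c0 * z 0 1.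
    by rewrite c3E; ring.
  by rewrite -Y1 -Y2 -Y3; ring.
have c03 : c0 = c3.
  have -> : c0 = c1 + c2 - c3 by rewrite c3E; ring.
  by rewrite c13 c23 addrK.
move: X1 Y1 X2 Y2 L1 L2; rewrite c13 c23 -c03 => X1 Y1 X2 Y2 L1 L2.
have divt x y : t * x + y = t * 0 + y -> x = 0 by move=> /addIr/(mulfI t0).
have Al k : A last_ix (affine_ix k) = 0.
  by case: (ord2P k) => ->; apply: divt; rewrite mulr0 add0r; [exact: L1|exact: L2].
have Ax j k : A (affine_ix j) (affine_ix k) = c0 * (j == k)%:R.
  apply/(mulfI t0); apply: (addIr (c0 * z 0 j)).
  case: (ord2P k) => ->; case: (ord2P j) => -> /=.
  - by rewrite X1; ring.
  - by rewrite Y1; ring.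
  - by rewrite X2; ring.
  - by rewrite Y2; ring.
have affine_neq_last k : (affine_ix k == last_ix) = false.
  by rewrite -val_eqE /= addn0 ltn_eqF.
have Ac i : A i last_ix = c0 * hvec z i 0 - \sum_k z 0 k * A i (affine_ix k).
  move/matrixP/(_ i 0): E0; rewrite mul_hvecE [RHS]mxE => <-.
  by rewrite addrAC subrr add0r.
exists c0; apply/matrixP => i j; rewrite mxE.
case: (affine_or_lastP i) => [[k ->]| ->]; case: (affine_or_lastP j) => [[l ->]| ->].
- by rewrite Ax mulr_natr.
- rewrite Ac hvec_affine (bigD1 k)//= big1 => [|l lk]; rewrite Ax.
    by rewrite eqxx mulr1 addr0 mulrC subrr affine_neq_last.
  by rewrite eq_sym (negbTE lk) !mulr0.
- by rewrite Al eq_sym affine_neq_last.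
- by rewrite Ac hvec_last big1 ?subr0 ?mulr1// => k _; rewrite Al mulr0.
Qed.

End ProjectiveAction.

(** * Deck transformations and the cube root of the canonical bundle *)

Section BallQuotient.
Set Implicit Arguments.
Unset Strict Implicit.
Local Open Scope classical_set_scope.
Local Open Scope ring_scope.
Variables (R : realType) (Pi : groupClosed (PU21 R)).
Local Notation C := (Cplx R).
Local Notation X := (ball_quotient Pi).
Local Notation A := (ball_quotient_atlas Pi).
Local Notation dom V := (@chart_dom _ _ A V).
Local Notation cod V := (@chart_cod _ _ A V).
Local Notation cmap V := (@chart_map _ _ A V).
Local Notation cinv V := (@chart_inv _ _ A V).
Implicit Types (V W U : chart_index A) (z w y : 'rV[C]_2) (x : X).

Lemma cocycle_cube (t a b c a1 b1 c1 a2 b2 c2 : C) :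
  a * t = a1 * a2 -> b * t = b1 * b2 -> c * t = c1 * c2 ->
  a * (b * c) * t ^+ 3 = a1 * (b1 * c1) * (a2 * (b2 * c2)).
Proof.
move=> at_ bt ct; transitivity (a * t * (b * t * (c * t))); first by ring.
by rewrite at_ bt ct; ring.
Qed.

Lemma PiM g h : g \in Pi -> h \in Pi -> (g * h)%g \in Pi.
Proof. exact: gpredM. Qed.

(** Charts of the quotient take values in the ball itself, so two chart points
    lie over the same point exactly when [Pi] identifies them. *)
Lemma chart_inv_eqP V W z w : cod V z -> cod W w ->
  cinv V z = cinv W w <-> exists2 g, g \in Pi & moves g z w.
Proof.
move=> [b _ <-] [c _ <-] /=; rewrite /insubd !valK /=.
have bcP := @eqmodP _ (orbit_equiv Pi) b c.
by split=> [/bcP/asboolP|/asboolP/bcP].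
Qed.

Lemma moves_frac_action u z w :
  moves (U21_to_PU21 u) z w <->
  automorphy (U21_mx u) z != 0 /\ frac_action (U21_mx u) z = w.
Proof.
rewrite moves_pi; split=> [[c cE]|[a0 <-]]; last first.
  by exists (automorphy (U21_mx u) z); exact: frac_actionE.
have c0 : c != 0.
  apply/eqP => c0; have /eqP := hvec_neq0 z; apply.
  by rewrite -[LHS](mulKmx (U21_unit u)) cE c0 scale0r mulmx0.
by have [-> ->] := frac_action_unique cE c0.
Qed.

Variable s : PU21 R -> SU21 R.
Hypothesis s_lift : {in Pi, forall g, SU21_to_PU21 (s g) = g}.
Hypothesis sM : {in Pi &, {morph s : g h / (g * h)%g}}.
Hypothesis atlasA : is_complex_atlas A.

Local Notation lift g := (SU21_mx (s g)).

Lemma moves_lift g z w : g \in Pi ->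
  moves g z w <-> automorphy (lift g) z != 0 /\ frac_action (lift g) z = w.
Proof. by move=> gP; rewrite -{1}(s_lift gP); exact: moves_frac_action. Qed.

Lemma dom_cmap V x : dom V x -> cod V (cmap V x) /\ cinv V (cmap V x) = x.
Proof. by case: atlasA => _ _ /(_ V)[+ _] _ _; exact. Qed.

Lemma cod_cinv V z : cod V z -> dom V (cinv V z) /\ cmap V (cinv V z) = z.
Proof. by case: atlasA => _ _ /(_ V)[_ +] _ _; exact. Qed.

Lemma open_cod V : open (cod V).
Proof. by case: atlasA => _ /(_ V)[]. Qed.

(** A change of charts is the action of one [g] on a whole neighbourhood:
    [g y] stays in the open codomain of the second chart, on which the projection
    is injective, so it is the coordinate of the point over [y] there. *)
Lemma near_moves g V W z w : cod V z -> cod W w -> g \in Pi -> moves g z w ->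
  \forall y \near z, [/\ cod V y, moves g y (frac_action (lift g) y),
    dom W (cinv V y) & cmap W (cinv V y) = frac_action (lift g) y].
Proof.
move=> zV wW gP /(moves_lift _ _ gP)[a0 fz].
have near_V : \forall y \near z, cod V y.
  by apply: open_nbhs_nbhs; split=> //; exact: open_cod.
have near_W : \forall y \near z, cod W (frac_action (lift g) y).
  have /differentiable_continuous c : differentiable (frac_action (lift g)) z.
    exact: (@ex_diff _ _ _ _ _ _ _ (is_diff_frac_action a0)).
  apply: (c (cod W)); apply: open_nbhs_nbhs; rewrite fz; split=> //.
  exact: open_cod.
have near_a := near_automorphy_neq0 a0.
near=> y.
have yV : cod V y by near: y.
have yW : cod W (frac_action (lift g) y) by near: y.
have gy : moves g y (frac_action (lift g) y).
  have a : automorphy (lift g) y != 0 by near: y.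
  exact: (moves_lift _ _ gP).2 (conj a erefl).
have -> : cinv V y = cinv W (frac_action (lift g) y).
  by apply/chart_inv_eqP => //; exists g.
by have [] := cod_cinv yW.
Unshelve. all: by end_near. Qed.

(** Freeness of the action at the points covered by charts. An element fixing
    [z] maps the nearby [y] to points of the same chart lying over the same point
    of the quotient, hence fixes them all, and so it is scalar. *)
Lemma fixpoint_trivial g V z : cod V z -> g \in Pi -> moves g z z -> g = 1%g.
Proof.
move=> zV gP gz.
have : \forall y \near z, exists c : C, lift g *m hvec y = c *: hvec y.
  have := near_moves zV zV gP gz; apply: filterS => y [yV gy _].
  have [_ ->] := cod_cinv yV => fy.
  move: gy; rewrite -fy => /(moves_lift _ _ gP)[a0 {}fy].
  exists (automorphy (lift g) y); move: (frac_actionE a0); rewrite fy; exact.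
move=> /near_fix_scalar[c gc].
rewrite -(s_lift gP) /SU21_to_PU21 -[RHS]/(U21_to_PU21 1%g).
apply/U21_to_PU21P; exists c.
by rewrite [LHS]gc -scalemx1.
Qed.

Lemma moves_inj g h V z w : cod V z -> g \in Pi -> h \in Pi ->
  moves g z w -> moves h z w -> g = h.
Proof.
move=> zV gP hP gz hz.
have /(fixpoint_trivial zV) : moves (h^-1 * g)%g z z.
  exact: movesM (movesV hz) gz.
rewrite gpredM ?gpredV// => /(_ isT) /(congr1 (fun k => h * k)%g).
by rewrite mulgA mulgV mul1g mulg1.
Qed.

(** Where both charts contain [x], such a [g] exists and is unique; elsewhere the
    default value is irrelevant. *)
Definition deck V W x : PU21 R :=
  xget 1%g [set g | g \in Pi /\ moves g (cmap V x) (cmap W x)].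

Lemma deckP V W x : dom V x -> dom W x ->
  deck V W x \in Pi /\ moves (deck V W x) (cmap V x) (cmap W x).
Proof.
move=> /dom_cmap[Vz Vx] /dom_cmap[Ww Wx].
have /(chart_inv_eqP Vz Ww)[g gP gzw] : cinv V (cmap V x) = cinv W (cmap W x).
  by rewrite Vx Wx.
by apply: (@xgetPex _ _ [set g | g \in Pi /\ _]); exists g.
Qed.

Lemma deck_unique g V W x : dom V x -> dom W x -> g \in Pi ->
  moves g (cmap V x) (cmap W x) -> deck V W x = g.
Proof.
move=> Vx Wx gP gx; have [dP dx] := deckP Vx Wx.
exact: moves_inj (dom_cmap Vx).1 dP gP dx gx.
Qed.

Lemma deckM U V W x : dom U x -> dom V x -> dom W x ->
  deck U W x = (deck V W x * deck U V x)%g.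
Proof.
move=> Ux Vx Wx; have [gP gx] := deckP Vx Wx; have [hP hx] := deckP Ux Vx.
exact: deck_unique Ux Wx (PiM gP hP) (movesM gx hx).
Qed.

(** Inverse automorphy factor of the deck transformation. The section [s] enters
    here: lifts of [g] to U(2,1) are defined up to scalars, and a choice that is
    not multiplicative would in general break the cocycle rule. *)
Definition cube_root_trans V W x : C :=
  (automorphy (lift (deck V W x)) (cmap V x))^-1.

Lemma cube_root_trans_neq0 V W x : dom V x -> dom W x ->
  cube_root_trans V W x != 0.
Proof.
move=> Vx Wx; have [gP] := deckP Vx Wx.
by move=> /(moves_lift _ _ gP)[a0 _]; rewrite invr_eq0.
Qed.

Lemma cube_root_transM U V W x : dom U x -> dom V x -> dom W x ->
  cube_root_trans U W x = cube_root_trans U V x * cube_root_trans V W x.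
Proof.
move=> Ux Vx Wx; have [gP gx] := deckP Vx Wx; have [hP hx] := deckP Ux Vx.
rewrite /cube_root_trans (deckM Ux Vx Wx) -invfM; congr (_^-1).
have -> : lift (deck V W x * deck U V x)%g = lift (deck V W x) *m lift (deck U V x).
  by rewrite (sM gP hP).
move: hx => /(moves_lift _ _ hP)[b0 bE].
by rewrite (automorphyM _ (frac_actionE b0)) bE mulrC.
Qed.

(** The deck transformation between two charts is locally constant. *)
Lemma near_deck V W z : cod V z -> dom W (cinv V z) ->
  exists2 g, g \in Pi & automorphy (lift g) z != 0 /\
  \forall y \near z, [/\ cod V y, dom W (cinv V y),
    cmap W (cinv V y) = frac_action (lift g) y & deck V W (cinv V y) = g].
Proof.
move=> Vz Wx; have [Vx zE] := cod_cinv Vz.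
have [gP] := deckP Vx Wx; set g := deck _ _ _ in gP *; rewrite zE => gz.
exists g => //; split; first by have /(moves_lift _ _ gP)[] := gz.
have := near_moves Vz (dom_cmap Wx).1 gP gz.
apply: filterS => y [Vy gy Wy fy]; have [Vy' yE] := cod_cinv Vy.
split; [exact: Vy|exact: Wy|exact: fy|].
by apply: (deck_unique Vy' Wy gP); rewrite yE fy.
Qed.

(** The change of charts is the action of [lift g], whose Jacobian determinant is
    [det (lift g) / j^3], and [det (lift g) = 1] because the lift is in SU(2,1). *)
Lemma canonical_transE V W x : dom V x -> dom W x ->
  @lb_trans _ _ (canonical_bundle A) V W x = cube_root_trans V W x ^+ 3.
Proof.
move=> Vx Wx; have [Vz xE] := dom_cmap Vx.
have Wz : dom W (cinv V (cmap V x)) by rewrite xE.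
have [g gP [a0 near_g]] := near_deck Vz Wz.
have gE : deck V W x = g by have [_ _ _] := nbhs_singleton near_g; rewrite xE.
have near_f : \forall y \near cmap V x,
    frac_action (lift g) y = (cmap W \o cinv V) y.
  by apply: filterS near_g => y [_ _ + _]; exact: esym.
have df := @ex_diff _ _ _ _ _ _ _ (is_diff_frac_action a0).
apply: etrans (congr1 determinant (near_eq_jacobian near_f df)) _.
rewrite (det_jacobian_frac_action a0) (SU21_mxP (s g)).2 /cube_root_trans gE.
by rewrite exprVn div1r.
Qed.

(** Read in a third chart [U], the transition from [V] to [W] is the quotient of
    those from [U] to [W] and from [U] to [V], which are inverses of affine
    functions of the coordinate in [U]. *)
Lemma cube_root_trans_holomorphic V W :
  holomorphic_on A (dom V `&` dom W) (cube_root_trans V W).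
Proof.
move=> U z Uz [Vx Wx].
have [g gP [g0 near_g]] := near_deck Uz Vx.
have [h hP [h0 near_h]] := near_deck Uz Wx.
have dgh : differentiable (automorphy (lift g) * (fun y => (automorphy (lift h) y)^-1)) z.
  apply: differentiableM; first exact: differentiable_automorphy.
  by apply: differentiableV => //; exact: differentiable_automorphy.
apply: (near_eq_diff _ dgh).1.
near=> y.
have [Uy Vy _ gE] : [/\ cod U y, dom V (cinv U y),
    cmap V (cinv U y) = frac_action (lift g) y & deck U V (cinv U y) = g].
  by near: y.
have [_ Wy _ hE] : [/\ cod U y, dom W (cinv U y),
    cmap W (cinv U y) = frac_action (lift h) y & deck U W (cinv U y) = h].
  by near: y.
have [Uy' yE] := cod_cinv Uy.
have UV0 := cube_root_trans_neq0 Uy' Vy.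
transitivity ((cube_root_trans U V (cinv U y))^-1 * cube_root_trans U W (cinv U y)).
  by rewrite /cube_root_trans gE hE yE invrK.
by rewrite (cube_root_transM Uy' Vy Wy) mulKf.
Unshelve. all: by end_near. Qed.

Definition canonical_cube_root : line_bundle_data R X :=
  {| lb_index := chart_index A;
     lb_open := @chart_dom _ _ A;
     lb_trans := cube_root_trans |}.

Lemma canonical_cube_root_holomorphic :
  holomorphic_line_bundle A canonical_cube_root.
Proof.
case: atlasA => cover opens _ _ _; split.
- exact: cover.
- by move=> V; have [] := opens V.
- exact: cube_root_trans_holomorphic.
- exact: cube_root_trans_neq0.
- by move=> U V W x Ux Vx Wx; exact: cube_root_transM.
Qed.

Lemma canonical_cube_root_iso :
  line_bundle_iso A (canonical_bundle A)
    (line_bundle_tensor canonical_cube_root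
      (line_bundle_tensor canonical_cube_root canonical_cube_root)).
Proof.
(* By convention an isomorphism multiplies a section in the chart [V] to get one
   in [W], so its coefficient is built from the transitions from [W] to [V]. *)
exists (fun V (W : chart_index A * (chart_index A * chart_index A)) x =>
  cube_root_trans W.1 V x *
  (cube_root_trans W.2.1 V x * cube_root_trans W.2.2 V x)); split; last split.
- move=> V [W1 [W2 W3]] U z Uz [Vx [W1x [W2x W3x]]] /=.
  apply: differentiableM.
    exact: (cube_root_trans_holomorphic Uz (conj W1x Vx)).
  apply: differentiableM.
    exact: (cube_root_trans_holomorphic Uz (conj W2x Vx)).
  exact: (cube_root_trans_holomorphic Uz (conj W3x Vx)).
- move=> V [W1 [W2 W3]] x Vx [W1x [W2x W3x]] /=.
  apply: mulf_neq0 (cube_root_trans_neq0 W1x Vx) _.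
  exact: mulf_neq0 (cube_root_trans_neq0 W2x Vx) (cube_root_trans_neq0 W3x Vx).
- move=> V V' [W1 [W2 W3]] [W1' [W2' W3']] x Vx V'x.
  move=> [W1x [W2x W3x]] [W1x' [W2x' W3x']].
  rewrite (canonical_transE Vx V'x) /=.
  have E W W' : dom W x -> dom W' x ->
      cube_root_trans W V x * cube_root_trans V V' x =
      cube_root_trans W W' x * cube_root_trans W' V' x.
    move=> Wx Wx'.
    exact: etrans (esym (cube_root_transM Wx Vx V'x)) (cube_root_transM Wx Wx' V'x).
  exact: cocycle_cube (E _ _ W1x W1x') (E _ _ W2x W2x') (E _ _ W3x W3x').
Qed.

End BallQuotient.

Theorem mainTheorem4 (R : realType) (Pi : groupClosed (PU21 R)) :
  torsion_free Pi -> discrete_subgroup Pi -> cocompact Pi ->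
  fake_projective_plane (ball_quotient_atlas Pi) ->
  extension_splits Pi ->
  exists L : line_bundle_data R (ball_quotient Pi),
    holomorphic_line_bundle (ball_quotient_atlas Pi) L /\
    line_bundle_iso (ball_quotient_atlas Pi)
      (canonical_bundle (ball_quotient_atlas Pi))
      (line_bundle_tensor L (line_bundle_tensor L L)).
Proof.
move=> _ _ _ [[_ _ _ atlasA] _ _ _] [s [_ s_lift sM]].
exists (canonical_cube_root Pi s); split.
  exact: canonical_cube_root_holomorphic s_lift sM atlasA.
exact: canonical_cube_root_iso s_lift sM atlasA.
Qed.
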